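(* Let $M \models \mathbf{PA}^-$. The following are equivalent: 1. $M \models \bigcup_{n \in \omega} \mathbf{Coll}(\Sigma_n)$. 2. For every $N \models \mathbf{PA}^-$, if $M \prec N$, then $M \prec \sup_N(M) \prec N$. 3. For every $N \models \mathbf{PA}^-$, if $M \prec N$, then $\sup_N(M) \prec N$.
   Context: $\mathcal{L}_A=\{0,1,+,\times,<\}$ is the language of first-order arithmetic, and $\mathbf{PA}^-$ is the $\mathcal{L}_A$-theory of the non-negative parts of commutative discretely ordered rings. $\Delta_0=\Sigma_0=\Pi_0$ is the class of $\mathcal{L}_A$-formulas all of whose quantifiers are bounded; $\Sigma_{n+1}$ (resp. $\Pi_{n+1}$) formulas are those of the form $\exists \vec{y}\,\varphi$ with $\varphi\in\Pi_n$ (resp. $\forall \vec{y}\,\varphi$ with $\varphi\in\Sigma_n$), where $\vec{y}$ is a finite, possibly empty, tuple. Vector notation denotes finite (possibly empty) tuples of variables or elements; for tuples of the same length, $\vec{x}<\vec{u}$ means $x_i<u_i$ for every $i$. $M\prec N$ means $N$ is an elementary extension of $M$. For $M,N\models\mathbf{PA}^-$ with $M$ a substructure of $N$, $\sup_N(M):=\{a\in N\mid \exists b\in M\ (N\models a\leq b)\}$, regarded as a substructure of $N$ (it is again a model of $\mathbf{PA}^-$). $\mathbf{Coll}(\Gamma)$ is the scheme $\forall \vec{z}\,\forall \vec{u}\,(\forall \vec{x}<\vec{u}\,\exists \vec{y}\,\varphi(\vec{x},\vec{y},\vec{z})\to\exists \vec{v}\,\forall \vec{x}<\vec{u}\,\exists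 \vec{y}<\vec{v}\,\varphi(\vec{x},\vec{y},\vec{z}))$ for $\varphi\in\Gamma$. *)

(* Defs.v *)
From mathcomp Require Import all_boot all_order all_algebra.

Set Implicit Arguments.
Unset Strict Implicit.
Unset Printing Implicit Defensive.

Import Order.TTheory GRing.Theory Num.Theory.

(* Variables are de Bruijn indices: a quantifier binds index 0 of its body. *)

Inductive term : Type :=
| Var of nat
| Zero
| One
| Add of term & term
| Mul of term & term.

Inductive formula : Type :=
| Eq of term & term
| Lt of term & term
| Fal
| Not of formula
| And of formula & formula
| Or of formula & formula
| Imp of formula & formula
| All of formula
| Ex of formula.

Definition Tru : formula := Not Fal.

Definition Le (s t : term) : formula := Or (Lt s t) (Eq s t).

Fixpoint ren_term (r : nat -> nat) (t : term) : term :=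
  match t with
  | Var i => Var (r i)
  | Zero => Zero
  | One => One
  | Add s t => Add (ren_term r s) (ren_term r t)
  | Mul s t => Mul (ren_term r s) (ren_term r t)
  end.

Definition up (r : nat -> nat) (i : nat) : nat :=
  if i is i'.+1 then (r i').+1 else 0.

Fixpoint ren (r : nat -> nat) (phi : formula) : formula :=
  match phi with
  | Eq s t => Eq (ren_term r s) (ren_term r t)
  | Lt s t => Lt (ren_term r s) (ren_term r t)
  | Fal => Fal
  | Not p => Not (ren r p)
  | And p q => And (ren r p) (ren r q)
  | Or p q => Or (ren r p) (ren r q)
  | Imp p q => Imp (ren r p) (ren r q)
  | All p => All (ren (up r) p)
  | Ex p => Ex (ren (up r) p)
  end.

Definition alls (k : nat) (phi : formula) : formula := iter k All phi.
Definition exs (k : nat) (phi : formula) : formula := iter k Ex phi.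

(* Shifting the bound [t] expresses that the bounded variable does not occur
   in it. *)
Inductive Delta0 : formula -> Prop :=
| Delta0_eq s t : Delta0 (Eq s t)
| Delta0_lt s t : Delta0 (Lt s t)
| Delta0_fal : Delta0 Fal
| Delta0_not p : Delta0 p -> Delta0 (Not p)
| Delta0_and p q : Delta0 p -> Delta0 q -> Delta0 (And p q)
| Delta0_or p q : Delta0 p -> Delta0 q -> Delta0 (Or p q)
| Delta0_imp p q : Delta0 p -> Delta0 q -> Delta0 (Imp p q)
| Delta0_all t p :
    Delta0 p -> Delta0 (All (Imp (Lt (Var 0) (ren_term succn t)) p))
| Delta0_ex t p :
    Delta0 p -> Delta0 (Ex (And (Lt (Var 0) (ren_term succn t)) p)).

Fixpoint Sigma (n : nat) (phi : formula) : Prop :=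
  match n with
  | 0 => Delta0 phi
  | m.+1 => exists k psi, phi = exs k psi /\ Pi m psi
  end
with Pi (n : nat) (phi : formula) : Prop :=
  match n with
  | 0 => Delta0 phi
  | m.+1 => exists k psi, phi = alls k psi /\ Sigma m psi
  end.

Record structure : Type := Structure {
  carrier :> Type;
  zero : carrier;
  one : carrier;
  add : carrier -> carrier -> carrier;
  mul : carrier -> carrier -> carrier;
  lt : carrier -> carrier -> Prop
}.

Arguments zero {s}.
Arguments one {s}.
Arguments add {s} _ _.
Arguments mul {s} _ _.
Arguments lt {s} _ _.

Definition le (M : structure) (a b : M) : Prop := lt a b \/ a = b.

Definition scons (M : Type) (a : M) (rho : nat -> M) (i : nat) : M :=
  if i is i'.+1 then rho i' else a.

Fixpoint eval (M : structure) (rho : nat -> M) (t : term) : M :=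
  match t with
  | Var i => rho i
  | Zero => zero
  | One => one
  | Add s t => add (eval rho s) (eval rho t)
  | Mul s t => mul (eval rho s) (eval rho t)
  end.

Fixpoint sat (M : structure) (rho : nat -> M) (phi : formula) : Prop :=
  match phi with
  | Eq s t => eval rho s = eval rho t
  | Lt s t => lt (eval rho s) (eval rho t)
  | Fal => False
  | Not p => ~ sat rho p
  | And p q => sat rho p /\ sat rho q
  | Or p q => sat rho p \/ sat rho q
  | Imp p q => sat rho p -> sat rho q
  | All p => forall a : M, sat (scons a rho) p
  | Ex p => exists a : M, sat (scons a rho) p
  end.

Definition theory : Type := formula -> Prop.

(* Free variables of the members of a theory are read as universally
   quantified. *)
Definition models (M : structure) (T : theory) : Prop :=
  forall phi, T phi -> forall rho : nat -> M, sat rho phi.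

Section NonNegativePart.
Local Open Scope ring_scope.

Definition discretely_ordered (R : realDomainType) : Prop :=
  forall x : R, ~ (0 < x < 1).

Definition nneg (R : realDomainType) : structure := {|
  carrier := {x : R | 0 <= x};
  zero := exist _ 0 (lexx 0);
  one := exist _ 1 ler01;
  add x y := exist _ (sval x + sval y) (addr_ge0 (svalP x) (svalP y));
  mul x y := exist _ (sval x * sval y) (mulr_ge0 (svalP x) (svalP y));
  lt x y := sval x < sval y
|}.

(* The set of all L_A-formulas valid in every non-negative part of a
   commutative discretely ordered ring. *)
Definition PAminus : theory := fun phi =>
  forall R : realDomainType, discretely_ordered R ->
  forall rho : nat -> nneg R, sat rho phi.

End NonNegativePart.

(* Substructures M of N are presented by their inclusion maps j : M -> N. *)
Record embedding (M N : structure) (j : M -> N) : Prop := {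
  emb_inj : injective j;
  emb_zero : j zero = zero;
  emb_one : j one = one;
  emb_add : forall a b, j (add a b) = add (j a) (j b);
  emb_mul : forall a b, j (mul a b) = mul (j a) (j b);
  emb_lt : forall a b, lt a b <-> lt (j a) (j b)
}.

Record elementary (M N : structure) (j : M -> N) : Prop := {
  elem_emb :> embedding j;
  elem_sat : forall phi (rho : nat -> M),
    sat rho phi <-> sat (fun i => j (rho i)) phi
}.

Lemma nneg_leE (R : realDomainType) (x y : nneg R) :
  le x y <-> (sval x <= sval y)%R.
Proof.
split=> [[/ltW //|-> //]|]; rewrite le_eqVlt => /orP[/eqP e|]; last by left.
by right; apply: val_inj.
Qed.

Lemma PAminus_le_add (N : structure) (hN : models N PAminus) (a b c d : N) :
  le a b -> le c d -> le (add a c) (add b d).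
Proof.
pose phi := Imp (Le (Var 0) (Var 1)) (Imp (Le (Var 2) (Var 3))
              (Le (Add (Var 0) (Var 2)) (Add (Var 1) (Var 3)))).
suff h : PAminus phi.
  exact: (hN phi h (scons a (scons b (scons c (scons d (fun=> a)))))).
move=> R _ rho.
move=> /(nneg_leE (rho 0) (rho 1)) h1 /(nneg_leE (rho 2) (rho 3)) h2.
by apply/(nneg_leE (add (rho 0) (rho 2)) (add (rho 1) (rho 3))); apply: lerD.
Qed.

Lemma PAminus_le_mul (N : structure) (hN : models N PAminus) (a b c d : N) :
  le a b -> le c d -> le (mul a c) (mul b d).
Proof.
pose phi := Imp (Le (Var 0) (Var 1)) (Imp (Le (Var 2) (Var 3))
              (Le (Mul (Var 0) (Var 2)) (Mul (Var 1) (Var 3)))).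
suff h : PAminus phi.
  exact: (hN phi h (scons a (scons b (scons c (scons d (fun=> a)))))).
move=> R _ rho.
move=> /(nneg_leE (rho 0) (rho 1)) h1 /(nneg_leE (rho 2) (rho 3)) h2.
apply/(nneg_leE (mul (rho 0) (rho 2)) (mul (rho 1) (rho 3))).
by apply: ler_pM => //; [exact: (svalP (rho 0)) | exact: (svalP (rho 2))].
Qed.

Section Sup.
Variables (M N : structure) (j : M -> N).

Definition in_sup (a : N) : Prop := exists b : M, le a (j b).

Hypotheses (hN : models N PAminus) (hj : embedding j).

Lemma in_sup_image (b : M) : in_sup (j b).
Proof. by exists b; right. Qed.

Lemma in_sup_zero : in_sup zero.
Proof. by exists zero; right; rewrite (emb_zero hj). Qed.

Lemma in_sup_one : in_sup one.
Proof. by exists one; right; rewrite (emb_one hj). Qed.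

Lemma in_sup_add (a c : N) : in_sup a -> in_sup c -> in_sup (add a c).
Proof.
move=> [b hb] [d hd]; exists (add b d); rewrite (emb_add hj).
exact: PAminus_le_add.
Qed.

Lemma in_sup_mul (a c : N) : in_sup a -> in_sup c -> in_sup (mul a c).
Proof.
move=> [b hb] [d hd]; exists (mul b d); rewrite (emb_mul hj).
exact: PAminus_le_mul.
Qed.

Definition sup : structure := {|
  carrier := {a : N | in_sup a};
  zero := exist _ zero in_sup_zero;
  one := exist _ one in_sup_one;
  add x y := exist _ (add (sval x) (sval y)) (in_sup_add (svalP x) (svalP y));
  mul x y := exist _ (mul (sval x) (sval y)) (in_sup_mul (svalP x) (svalP y));
  lt x y := lt (sval x) (sval y)
|}.

Definition to_sup (b : M) : sup := exist _ (j b) (in_sup_image b).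

Definition of_sup (x : sup) : N := sval x.

End Sup.

Arguments of_sup {M N j} hN hj x.

(* The tuples of variables with indices a, ..., a + k - 1 and
   b, ..., b + k - 1, compared componentwise. *)
Fixpoint vec_lt (k a b : nat) : formula :=
  if k is k'.+1 then And (Lt (Var a) (Var b)) (vec_lt k' a.+1 b.+1) else Tru.

(* Makes room for d new variables at indices c, ..., c + d - 1. *)
Definition insert (c d i : nat) : nat := if i < c then i else i + d.

(* In phi, the tuple y consists of the indices 0, ..., l - 1, the tuple x of
   the indices l, ..., l + k - 1, and the parameters z of the remaining
   indices.  The parameters are left free, see [models].  The indices under
   the quantifiers below, innermost block first, are y, x, u, z in the
   hypothesis and y, x, v, u, z in the conclusion. *)
Definition coll (k l : nat) (phi : formula) : formula :=
  alls k (Imp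
    (alls k (Imp (vec_lt k 0 k)
      (exs l (ren (insert (l + k) k) phi))))
    (exs l (alls k (Imp (vec_lt k 0 (k + l))
      (exs l (And (vec_lt l 0 (l + k))
        (ren (insert (l + k) (l + k)) phi))))))).

Definition Coll (Gamma : formula -> Prop) : theory := fun psi =>
  exists k l phi, Gamma phi /\ psi = coll k l phi.

(* Main.v *)
(* If M satisfies collection, then for every formula phi and every bound u in M
   some v in M bounds a witness y of phi(x, y) for all x < u that have one.  By
   elementarity the same v works in N, so the supremum K of M passes the
   Tarski-Vaught test in N.  Conversely, if collection for phi fails at u, then
   in an ultrapower N of M some tuple c < u has no witness y below an element of
   M.  This c lies in K, and a witness in K would lie below an element of M, so
   phi(c, y) is satisfiable in N but not in K.  Prenex forms reduce collection
   for all formulas to collection for the classes Sigma_n. *)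

From mathcomp Require Import all_boot all_order all_algebra.
From mathcomp Require Import boolp classical_sets filter.
Require Import Defs.

Set Implicit Arguments.
Unset Strict Implicit.
Unset Printing Implicit Defensive.

(** * Tuples prepended to assignments *)

Definition vcat (A : Type) k (t rho : nat -> A) (i : nat) : A :=
  if i < k then t i else rho (i - k).

Section Assignments.
Variables A B : Type.
Implicit Types t rho : nat -> A.

Lemma vcat0 t rho : vcat 0 t rho = rho.
Proof. by apply/funext => i; rewrite /vcat subn0. Qed.

(** In a quantifier block the outermost quantifier binds the highest index, so blocks are peeled
    from the last entry of the tuple. *)
Lemma vcatS k t rho : vcat k.+1 t rho = vcat k t (scons (t k) rho).
Proof.
apply/funext => i; rewrite /vcat ltnS leq_eqVlt.
by case: ltngtP => [//|ki|->] /=; rewrite ?subnn // -(subnSK ki).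
Qed.

Lemma vcat1 t rho : vcat 1 t rho = scons (t 0) rho.
Proof. by rewrite vcatS vcat0. Qed.

(** A tuple is a total sequence whose entries from [k] on are junk. This lets them be altered
    freely. *)
Lemma eq_vcat k t t' rho :
  (forall i, i < k -> t i = t' i) -> vcat k t rho = vcat k t' rho.
Proof. by move=> h; apply/funext => i; rewrite /vcat; case: ltnP => // /h. Qed.

Lemma vcat_comp (g : A -> B) k t rho :
  (fun i => g (vcat k t rho i)) = vcat k (g \o t) (g \o rho).
Proof. by apply/funext => i; rewrite /vcat; case: ifP. Qed.

Lemma scons_comp (g : A -> B) a rho :
  (fun i => g (scons a rho i)) = scons (g a) (g \o rho).
Proof. by apply/funext => -[]. Qed.

Lemma scons_up a rho r : scons a rho \o up r = scons a (rho \o r).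
Proof. by apply/funext => -[]. Qed.

(** Accounts for the renamings in [coll]: [d = k] skips the bound u in the hypothesis, [d = l + k]
    skips v and u in the conclusion. *)
Lemma vcat2_insert k l d (y x w rho : nat -> A) :
  vcat l y (vcat k x (vcat d w rho)) \o insert (l + k) d
  = vcat l y (vcat k x rho).
Proof.
apply/funext => i; rewrite /insert /vcat /=; case: (ltnP i (l + k)) => ilk.
  by case: (ltnP i l) => // li; rewrite ltn_subLR // ilk.
have li : l <= i by apply: leq_trans ilk; rewrite leq_addr.
have kil : k <= i - l by rewrite leq_subRL.
rewrite !ltnNge (leq_trans li (leq_addr _ _)) li kil /=.
rewrite -addnBAC // (leq_trans kil (leq_addr _ _)) /= -addnBAC //.
by rewrite leq_addl addnK.
Qed.

Lemma vcat_addE k t rho i : vcat k t rho (k + i) = rho i.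
Proof. by rewrite /vcat ltnNge leq_addr /= addKn. Qed.

Lemma vcat_ltE k t rho i : i < k -> vcat k t rho i = t i.
Proof. by rewrite /vcat => ->. Qed.

Lemma vcat_vcat k l (v u rho : nat -> A) :
  vcat l v (vcat k u rho) = vcat (l + k) (vcat l v u) rho.
Proof.
apply/funext => i; rewrite /vcat; case: (ltnP i l) => il.
  by rewrite ltn_addr.
by rewrite ltn_subLR // subnDA.
Qed.

End Assignments.

(** * Semantics of quantifier blocks and of collection *)

Section Semantics.
Variable M : structure.
Implicit Types (rho : nat -> M) (phi : formula).

Lemma eval_ren rho r s : eval rho (ren_term r s) = eval (rho \o r) s.
Proof. by elim: s => //= [s -> t ->|s -> t ->]. Qed.

Lemma sat_ren rho r phi : sat rho (ren r phi) <-> sat (rho \o r) phi.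
Proof.
elim: phi rho r => [s t|s t||p IHp|p IHp q IHq|p IHp q IHq|p IHp q IHq
  |p IHp|p IHp] rho r /=; rewrite ?eval_ren ?IHp ?IHq //.
- by split=> h a; move: (h a); rewrite IHp scons_up.
- by split=> -[a h]; exists a; move: h; rewrite IHp scons_up.
Qed.

Lemma sat_alls k phi rho :
  sat rho (alls k phi) <-> forall t, sat (vcat k t rho) phi.
Proof.
elim: k rho => [|k IHk] rho /=.
  by split=> [h t|/(_ rho)]; rewrite vcat0.
split=> [h t|h a]; first by move: (h (t k)); rewrite IHk vcatS; exact.
(* Only the entries of [t] below [k] matter, so one sequence can also hold [a] at index [k]. *)
rewrite IHk => t; move: (h (fun i => if i < k then t i else a)).
rewrite vcatS ltnn (@eq_vcat _ k _ t) // => i ik.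
by rewrite ik.
Qed.

Lemma sat_exs k phi rho :
  sat rho (exs k phi) <-> exists t, sat (vcat k t rho) phi.
Proof.
elim: k rho => [|k IHk] rho /=.
  by split=> [h|[t]]; [exists rho|]; rewrite vcat0.
split=> [[a]|[t]].
  rewrite IHk => -[t h]; exists (fun i => if i < k then t i else a).
  rewrite vcatS ltnn (@eq_vcat _ k _ t) // => i ik.
  by rewrite ik.
by rewrite vcatS => h; exists (t k); rewrite IHk; exists t.
Qed.

Lemma sat_vec_lt k a b rho :
  sat rho (vec_lt k a b) <-> forall i, i < k -> lt (rho (a + i)) (rho (b + i)).
Proof.
elim: k a b => [|k IHk] a b /=; first by split => // _ [].
rewrite IHk; split=> [[h0 h] [|i] // ik|h].
- by rewrite !addn0.
- by rewrite -!addSnnS; exact: h.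
- split=> [|i ik]; first by move: (h 0 isT); rewrite !addn0.
  by rewrite !addSnnS; exact: h.
Qed.

(** Kept as a formula of its own because, once u and v are fixed, it is transferred along an
    elementary map. *)
Definition coll_bounded k l phi : formula :=
  alls k (Imp (vec_lt k 0 (k + l))
    (exs l (And (vec_lt l 0 (l + k)) (ren (insert (l + k) (l + k)) phi)))).

Lemma sat_coll_bounded k l phi rho (u v : nat -> M) :
  sat (vcat l v (vcat k u rho)) (coll_bounded k l phi) <->
  forall x, (forall i, i < k -> lt (x i) (u i)) ->
  exists y, (forall i, i < l -> lt (y i) (v i)) /\
    sat (vcat l y (vcat k x rho)) phi.
Proof.
rewrite sat_alls; set env := vcat l v _.
have envu i : i < k -> env (l + i) = u i.
  by move=> ik; rewrite /env vcat_addE vcat_ltE.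
have envv i : i < l -> env i = v i by exact: vcat_ltE.
have envE : env = vcat (l + k) (vcat l v u) rho by exact: vcat_vcat.
have ltx x : sat (vcat k x env) (vec_lt k 0 (k + l)) <->
    (forall i, i < k -> lt (x i) (u i)).
  rewrite sat_vec_lt; split=> h i ik; move: (h i ik);
  by rewrite add0n -addnA vcat_addE envu // vcat_ltE.
have lty x y : sat (vcat l y (vcat k x env)) (vec_lt l 0 (l + k)) <->
    (forall i, i < l -> lt (y i) (v i)).
  rewrite sat_vec_lt; split=> h i il; move: (h i il);
  by rewrite add0n -addnA !vcat_addE envv // vcat_ltE.
have body x y : sat (vcat l y (vcat k x env)) (ren (insert (l + k) (l + k)) phi)
    <-> sat (vcat l y (vcat k x rho)) phi.
  by rewrite sat_ren envE vcat2_insert.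
split=> h x; move: (h x) => /=; rewrite ltx sat_exs => h' /h' [y].
- by rewrite /= lty body; exists y.
- by move=> hy; exists y; rewrite /= lty body.
Qed.

Lemma sat_coll k l phi rho :
  sat rho (coll k l phi) <-> forall u,
    (forall x, (forall i, i < k -> lt (x i) (u i)) ->
       exists y, sat (vcat l y (vcat k x rho)) phi) ->
    exists v, sat (vcat l v (vcat k u rho)) (coll_bounded k l phi).
Proof.
rewrite sat_alls.
have hyp u : sat (vcat k u rho) (alls k (Imp (vec_lt k 0 k)
      (exs l (ren (insert (l + k) k) phi)))) <->
    (forall x, (forall i, i < k -> lt (x i) (u i)) ->
       exists y, sat (vcat l y (vcat k x rho)) phi).
  rewrite sat_alls.
  have ltx x : sat (vcat k x (vcat k u rho)) (vec_lt k 0 k) <->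
      (forall i, i < k -> lt (x i) (u i)).
    rewrite sat_vec_lt; split=> h i ik; move: (h i ik);
    by rewrite add0n !vcat_addE !vcat_ltE.
  split=> h x; move: (h x) => /=; rewrite ltx sat_exs => h' /h' [y].
  - by rewrite sat_ren vcat2_insert; exists y.
  - by move=> hy; exists y; rewrite sat_ren vcat2_insert.
by split=> h u; move: (h u) => /=; rewrite hyp sat_exs.
Qed.

(** Collection bounds finite tuples only, while an assignment has infinitely many values; this
    reduces the parameters of a formula to a finite tuple. *)
Lemma sat_finite_support phi : exists n, forall rho rho' : nat -> M,
  (forall i, i < n -> rho i = rho' i) -> sat rho phi <-> sat rho' phi.
Proof.
have term_support s : exists n, forall rho rho' : nat -> M,
    (forall i, i < n -> rho i = rho' i) -> eval rho s = eval rho' s.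
  elim: s => [i|||s [m hm] t [n hn]|s [m hm] t [n hn]].
  - by exists i.+1 => rho rho'; exact.
  - by exists 0.
  - by exists 0.
  - exists (maxn m n) => rho rho' h /=.
    by rewrite (hm rho rho') ?(hn rho rho') // => i hi; apply: h;
      rewrite leq_max hi ?orbT.
  - exists (maxn m n) => rho rho' h /=.
    by rewrite (hm rho rho') ?(hn rho rho') // => i hi; apply: h;
      rewrite leq_max hi ?orbT.
have scons_agree n (a : M) (rho rho' : nat -> M) :
    (forall i, i < n -> rho i = rho' i) ->
    forall i, i < n -> scons a rho i = scons a rho' i.
  by move=> h [//|i] /= /ltnW; exact: h.
elim: phi => [s t|s t||p [m hm]|p [m hm] q [n hn]|p [m hm] q [n hn]
  |p [m hm] q [n hn]|p [m hm]|p [m hm]].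
- have [m hm] := term_support s; have [n hn] := term_support t.
  exists (maxn m n) => rho rho' h /=.
  rewrite (hm rho rho') ?(hn rho rho') // => i hi;
    by apply: h; rewrite leq_max hi ?orbT.
- have [m hm] := term_support s; have [n hn] := term_support t.
  exists (maxn m n) => rho rho' h /=.
  rewrite (hm rho rho') ?(hn rho rho') // => i hi;
    by apply: h; rewrite leq_max hi ?orbT.
- by exists 0.
- by exists m => rho rho' h /=; rewrite (hm rho rho').
- exists (maxn m n) => rho rho' h /=.
  rewrite (hm rho rho') ?(hn rho rho') // => i hi;
    by apply: h; rewrite leq_max hi ?orbT.
- exists (maxn m n) => rho rho' h /=.
  rewrite (hm rho rho') ?(hn rho rho') // => i hi;
    by apply: h; rewrite leq_max hi ?orbT.
- exists (maxn m n) => rho rho' h /=.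
  rewrite (hm rho rho') ?(hn rho rho') // => i hi;
    by apply: h; rewrite leq_max hi ?orbT.
- exists m => rho rho' h /=.
  by split=> hp a; move: (hp a); rewrite (hm _ _ (scons_agree m a _ _ h)).
- exists m => rho rho' h /=.
  split=> -[a hp]; exists a; move: hp;
    by rewrite (hm _ _ (scons_agree m a _ _ h)).
Qed.

End Semantics.

(** * Prenex forms *)

Section PrenexForm.

Definition equivalent (p q : formula) : Prop :=
  forall (M : structure) (rho : nat -> M), sat rho p <-> sat rho q.

Inductive open_formula : formula -> Prop :=
| open_eq s t : open_formula (Eq s t)
| open_lt s t : open_formula (Lt s t)
| open_fal : open_formula Fal
| open_not p : open_formula p -> open_formula (Not p)
| open_and p q : open_formula p -> open_formula q -> open_formula (And p q).

Inductive prenex : formula -> Prop :=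
| prenex_open p : open_formula p -> prenex p
| prenex_all p : prenex p -> prenex (All p)
| prenex_ex p : prenex p -> prenex (Ex p).

Lemma open_ren r p : open_formula p -> open_formula (ren r p).
Proof. by elim=> *; constructor. Qed.

Lemma prenex_ren r p : prenex p -> prenex (ren r p).
Proof.
move=> hp; elim: hp r => {p} [p hp|p _ IHp|p _ IHp] r /=.
- exact/prenex_open/open_ren.
- exact/prenex_all.
- exact/prenex_ex.
Qed.

(** A universal quantifier costs two levels, as an empty existential block is put before it. An
    existential one joins the leading block, or opens one at level 0. *)
Lemma prenex_Sigma p : prenex p -> exists n, Sigma n p.
Proof.
elim=> {p} [p hp|p _ [n hp]|p _ [[|n] hp]].
- by exists 0; elim: hp => *; constructor.
- by exists n.+2, 0, (All p); split=> //; exists 1, p.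
- by exists 1, 1, p.
- by case: hp => k [psi [-> hpsi]]; exists n.+1, k.+1, psi.
Qed.

Lemma prenex_not p : prenex p -> exists2 q, prenex q & equivalent q (Not p).
Proof.
elim=> {p} [p hp|p _ [q hq e]|p _ [q hq e]].
- by exists (Not p) => //; do 2?constructor.
- exists (Ex q); first by constructor.
  move=> M rho /=; rewrite -existsNP.
  by split=> -[a]; [rewrite e|rewrite -[~ _]/(sat _ (Not p)) -e]; exists a.
- exists (All q); first by constructor.
  move=> M rho /=; rewrite -forallNP.
  by split=> h a; move: (h a); [rewrite e|rewrite -[~ _]/(sat _ (Not p)) -e].
Qed.

Lemma sat_ren_succ (M : structure) (a : M) rho p :
  sat (scons a rho) (ren succn p) <-> sat rho p.
Proof. by rewrite sat_ren. Qed.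

(** The quantifiers of [p] are pulled out first, with [q] arbitrary, and those of [q] once [p] is
    open. The conjunct passed over is shifted each time. *)
Lemma prenex_and p q : prenex p -> prenex q ->
  exists2 r, prenex r & equivalent r (And p q).
Proof.
move=> hp; elim: hp q => {p} [p hp|p _ IHp|p _ IHp] q hq.
- elim: hq p hp => {q} [q hq|q _ IHq|q _ IHq] p hp.
  + by exists (And p q) => //; do 2?constructor.
  + have [r hr e] := IHq _ (open_ren succn hp).
    exists (All r); first by constructor.
    move=> M rho /=; split=> [h|[h1 h2] a].
      (* The shifted conjunct is recovered from a single instance; [zero] provides one. *)
      split=> [|a]; first by have /e[/sat_ren_succ] := h zero.
      by have /e[] := h a.
    by apply/e; split=> //=; apply/sat_ren_succ.
  + have [r hr e] := IHq _ (open_ren succn hp).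
    exists (Ex r); first by constructor.
    move=> M rho /=; split=> [[a /e[/sat_ren_succ ? ?]]|[? [a ?]]].
      by split=> //; exists a.
    by exists a; apply/e; split=> //=; apply/sat_ren_succ.
- have [r hr e] := IHp _ (prenex_ren succn hq).
  exists (All r); first by constructor.
  move=> M rho /=; split=> [h|[h1 h2] a].
    split=> [a|]; first by have /e[] := h a.
    by have /e[_ /sat_ren_succ] := h zero.
  by apply/e; split=> //=; apply/sat_ren_succ.
- have [r hr e] := IHp _ (prenex_ren succn hq).
  exists (Ex r); first by constructor.
  move=> M rho /=; split=> [[a /e[? /sat_ren_succ ?]]|[[a ?] ?]].
    by split=> //; exists a.
  by exists a; apply/e; split=> //=; apply/sat_ren_succ.
Qed.

Lemma prenex_form p : exists2 q, prenex q & equivalent q p.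
Proof.
have pnot p1 : (exists2 q, prenex q & equivalent q p1) ->
    exists2 q, prenex q & equivalent q (Not p1).
  move=> [q hq e]; have [r hr e'] := prenex_not hq; exists r => // M rho.
  by rewrite e' /= e.
have pand p1 p2 : (exists2 q, prenex q & equivalent q p1) ->
    (exists2 q, prenex q & equivalent q p2) ->
    exists2 q, prenex q & equivalent q (And p1 p2).
  move=> [q hq e] [r hr e']; have [s hs es] := prenex_and hq hr.
  by exists s => // M rho; rewrite es /= e e'.
elim: p => [s t|s t||p IHp|p IHp q IHq|p IHp q IHq|p IHp q IHq
  |p [q hq e]|p [q hq e]].
- by exists (Eq s t) => //; do 2!constructor.
- by exists (Lt s t) => //; do 2!constructor.
- by exists Fal => //; do 2!constructor.
- exact: pnot.
- exact: pand.
(* Disjunction and implication are classically negated conjunctions. *)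
- have [r hr e] := pnot _ (pand _ _ (pnot _ IHp) (pnot _ IHq)).
  by exists r => // M rho; rewrite e /= -not_orP notK.
- have [r hr e] := pnot _ (pand _ _ IHp (pnot _ IHq)).
  by exists r => // M rho; rewrite e /= -not_implyP notK.
- exists (All q); first by constructor.
  by move=> M rho /=; split=> h a; apply/e.
- exists (Ex q); first by constructor.
  by move=> M rho /=; split=> -[a /e]; exists a.
Qed.

End PrenexForm.

(** * Ultrapowers and the theorem of Łoś *)

Section UltraFilterTheory.
Variables (I : Type) (U : set_system I).
Hypothesis hU : UltraFilter U.

Lemma ultra_not (P : set I) : U (fun w => ~ P w) <-> ~ U P.
Proof.
split=> [hn hp|].
  by have [w []] := filter_ex (filterI hn hp).
by case: (in_ultra_setVsetC P hU).
Qed.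

Lemma ultra_and (P Q : set I) : U (fun w => P w /\ Q w) <-> U P /\ U Q.
Proof.
split=> [h|[hp hq]]; last exact: filterI.
by split; apply: filterS h => w [].
Qed.

Lemma eq_ultra (P Q : set I) : (forall w, P w <-> Q w) -> U P <-> U Q.
Proof. by move=> e; split; apply: filterS => w /e. Qed.

Lemma ultra_or (P Q : set I) : U (fun w => P w \/ Q w) <-> U P \/ U Q.
Proof.
rewrite -[_ \/ U Q]notK not_orP -!ultra_not -ultra_and -ultra_not.
by apply: eq_ultra => w; rewrite -not_orP notK.
Qed.

Lemma ultra_imp (P Q : set I) : U (fun w => P w -> Q w) <-> (U P -> U Q).
Proof.
rewrite -[U P -> _]notK not_implyP -!ultra_not -ultra_and -ultra_not.
by apply: eq_ultra => w; rewrite -not_implyP notK.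
Qed.

(** Witnesses are chosen index by index; the inhabitant of [T] is the default at indices without a
    witness. *)
Lemma ultra_ex (T : Type) (P : T -> set I) : T ->
  U (fun w => exists a, P a w) <-> exists f : I -> T, U (fun w => P (f w) w).
Proof.
move=> a0; split=> [h|[f]]; last by apply: filterS => w; exists (f w).
have /choice[f hf] w : exists b, (exists a, P a w) -> P b w.
  by have [[a]|h'] := pselect (exists a, P a w); [exists a|exists a0].
by exists f; apply: filterS h => w /hf.
Qed.

Variable M : structure.

Definition ultra_eq (f g : I -> M) : Prop := U (fun w => f w = g w).

Lemma ultra_eq_refl f : ultra_eq f f.
Proof. exact: filterE. Qed.

Lemma ultra_eqE (f g : I -> M) : ultra_eq f = ultra_eq g <-> ultra_eq f g.
Proof.
split=> [->|fg]; first exact: ultra_eq_refl.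
apply/funext => h; apply/propext.
by split; apply: filterS2 fg => w -> ->.
Qed.

(** The quotient is made of the equivalence classes themselves, as predicates, so that equivalent
    functions give equal elements, as the semantics of [Eq] demands. *)
Definition ultra_carrier : Type :=
  {C : (I -> M) -> Prop | exists f, C = ultra_eq f}.

Definition ultra_class (f : I -> M) : ultra_carrier :=
  exist _ (ultra_eq f) (ex_intro _ f erefl).

Definition ultra_repr (a : ultra_carrier) : I -> M := sval (cid (svalP a)).

Lemma ultra_classE (f g : I -> M) :
  ultra_class f = ultra_class g <-> ultra_eq f g.
Proof.
rewrite -ultra_eqE; split=> [e|]; last exact: eq_exist.
by have := congr1 sval e.
Qed.

Lemma ultra_reprK : cancel ultra_repr ultra_class.
Proof.
by rewrite /ultra_repr => -[C hC]; apply: eq_exist; case: cid => f /= ->.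
Qed.

Lemma ultra_classK f : U (fun w => ultra_repr (ultra_class f) w = f w).
Proof. by apply/ultra_classE; rewrite ultra_reprK. Qed.

(** The operations act on chosen representatives, so no compatibility has to be proved first;
    [ultra_classK] shows that the choice matters only off a set of the ultrafilter. *)
Definition ultrapower : structure := {|
  carrier := ultra_carrier;
  zero := ultra_class (fun=> zero);
  one := ultra_class (fun=> one);
  add a b := ultra_class (fun w => add (ultra_repr a w) (ultra_repr b w));
  mul a b := ultra_class (fun w => mul (ultra_repr a w) (ultra_repr b w));
  lt a b := U (fun w => lt (ultra_repr a w) (ultra_repr b w))
|}.

(* Typing the class by the structure lets [sat] and [lt] infer the latter. *)
Definition uclass (f : I -> M) : ultrapower := ultra_class f.

Lemma uclass_surj (a : ultrapower) : exists f, a = uclass f.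
Proof. by exists (ultra_repr a); rewrite /uclass ultra_reprK. Qed.

Lemma uclass_lt f g : lt (uclass f) (uclass g) <-> U (fun w => lt (f w) (g w)).
Proof.
split; apply: filterS3 (ultra_classK f) (ultra_classK g) => w;
  by rewrite /= /uclass => -> ->.
Qed.

Lemma eval_uclass (f : nat -> I -> M) s :
  eval (fun i => uclass (f i)) s = uclass (fun w => eval (f^~ w) s).
Proof.
elim: s => //= [s -> t ->|s -> t ->]; apply/ultra_classE;
  by apply: filterS2 (ultra_classK (fun w => eval (f^~ w) s))
    (ultra_classK (fun w => eval (f^~ w) t)) => w; rewrite /= /uclass => -> ->.
Qed.

Lemma scons_uclass g (f : nat -> I -> M) :
  scons (uclass g) (fun i => uclass (f i)) = (fun i => uclass (scons g f i)).
Proof. by apply/funext => -[]. Qed.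

Lemma scons_flip g (f : nat -> I -> M) w :
  (fun i => scons g f i w) = scons (g w) (f^~ w).
Proof. by apply/funext => -[]. Qed.

Theorem Los phi (f : nat -> I -> M) :
  sat (fun i => uclass (f i)) phi <-> U (fun w => sat (f^~ w) phi).
Proof.
(* Stated apart from the induction because the universal case uses it too, for [Not p]. *)
have sat_ex p (e : nat -> I -> M) :
    (forall e, sat (fun i => uclass (e i)) p <-> U (fun w => sat (e^~ w) p)) ->
    (exists a, sat (scons a (fun i => uclass (e i))) p) <->
    U (fun w => exists a : M, sat (scons a (e^~ w)) p).
  move=> IHp; rewrite (@ultra_ex _ _ (zero : M)); split=> [[a]|[g h]].
    have [g ->] := uclass_surj a; rewrite scons_uclass IHp => h.
    by exists g; apply: filterS h => w; rewrite scons_flip.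
  exists (uclass g); rewrite scons_uclass IHp.
  by apply: filterS h => w; rewrite scons_flip.
elim: phi f => [s t|s t||p IHp|p IHp q IHq|p IHp q IHq|p IHp q IHq|p IHp|p IHp]
  f /=.
- by rewrite !eval_uclass ultra_classE.
- have := uclass_lt (fun w => eval (f^~ w) s) (fun w => eval (f^~ w) t).
  by rewrite -!eval_uclass.
- by split=> // /filter_ex[].
- by rewrite ultra_not IHp.
- by rewrite ultra_and IHp IHq.
- by rewrite ultra_or IHp IHq.
- by rewrite ultra_imp IHp IHq.
- rewrite -[forall a, _]notK -existsNP (sat_ex (Not p)) => [|g /=]; last first.
    by rewrite ultra_not IHp.
  by rewrite -ultra_not; apply: eq_ultra => w; rewrite /= existsNP notK.
- exact: sat_ex.
Qed.

Definition diagonal (a : M) : ultrapower := uclass (fun=> a).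

Lemma diagonal_elementary : elementary diagonal.
Proof.
split=> [|phi rho]; last first.
  rewrite Los; split=> [h|/filter_ex[]//].
  exact: filterE.
split=> //.
- by move=> a b /ultra_classE/filter_ex[].
- move=> a b; apply/esym/ultra_classE.
  by apply: filterS2 (ultra_classK (fun=> a)) (ultra_classK (fun=> b)) => w;
    rewrite /= /diagonal /uclass => -> ->.
- move=> a b; apply/esym/ultra_classE.
  by apply: filterS2 (ultra_classK (fun=> a)) (ultra_classK (fun=> b)) => w;
    rewrite /= /diagonal /uclass => -> ->.
- move=> a b; rewrite uclass_lt.
  by split=> [h|/filter_ex[]//]; exact: filterE.
Qed.

Lemma ultrapower_models T : models M T -> models ultrapower T.
Proof.
move=> hM phi /hM h rho.
have -> : rho = (fun i => uclass (ultra_repr (rho i))).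
  by apply/funext => i; rewrite /uclass ultra_reprK.
by rewrite Los; exact: filterE.
Qed.

End UltraFilterTheory.

(** * Order laws and a cofinal ultrafilter *)

Section PAminusOrder.
Variables (M : structure) (hM : models M PAminus).

(** As [PAminus] consists of the formulas valid in all non-negative parts, each law is checked in an
    ordered ring and then read in [M] under a suitable assignment. *)
Lemma PAminus_lt_trans (a b c : M) : lt a b -> lt b c -> lt a c.
Proof.
have h : PAminus (Imp (Lt (Var 0) (Var 1)) (Imp (Lt (Var 1) (Var 2))
    (Lt (Var 0) (Var 2)))).
  by move=> R _ rho; exact: Order.POrderTheory.lt_trans.
exact: (hM h (scons a (scons b (fun=> c)))).
Qed.

Lemma PAminus_lt_succ (a : M) : lt a (add a one).
Proof.
have h : PAminus (Lt (Var 0) (Add (Var 0) One)).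
  by move=> R _ rho /=; rewrite Num.Theory.ltrDl Num.Theory.ltr01.
exact: (hM h (fun=> a)).
Qed.

Lemma PAminus_lt_addl (a b c : M) : lt (add a b) c -> lt a c.
Proof.
have h : PAminus (Imp (Lt (Add (Var 0) (Var 1)) (Var 2)) (Lt (Var 0) (Var 2))).
  move=> R _ rho /=; apply: Order.POrderTheory.le_lt_trans.
  by rewrite Num.Theory.lerDl; exact: (svalP (rho 1)).
exact: (hM h (scons a (scons b (fun=> c)))).
Qed.

Lemma PAminus_lt_addr (a b c : M) : lt (add a b) c -> lt b c.
Proof.
have h : PAminus (Imp (Lt (Add (Var 0) (Var 1)) (Var 2)) (Lt (Var 1) (Var 2))).
  move=> R _ rho /=; apply: Order.POrderTheory.le_lt_trans.
  by rewrite Num.Theory.lerDr; exact: (svalP (rho 0)).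
exact: (hM h (scons a (scons b (fun=> c)))).
Qed.

Lemma PAminus_le_lt_trans (a b c : M) : le a b -> lt b c -> lt a c.
Proof. by move=> [/PAminus_lt_trans|->]; exact. Qed.

(** The open final segments of [M] form a base of a proper filter. In the resulting ultrapower the
    class of the identity lies above every diagonal element. *)
Lemma cofinal_ultrafilter :
  exists2 U : set_system M, UltraFilter U & forall b, U (fun w => lt b w).
Proof.
pose cone (b : M) : set M := fun w => lt b w.
have [|U [hU sub]] := @ultraFilterLemma _ (filter_from setT cone).
  apply: filter_from_proper => [|b _]; last first.
    by exists (add b one); exact: PAminus_lt_succ.
  apply: filter_from_filter => [|a b _ _]; first by exists zero.
  (* The sum serves as a common upper bound in place of a maximum. *)
  by exists (add a b) => // w h; split;
    [exact: PAminus_lt_addl h|exact: PAminus_lt_addr h].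
by exists U => // b; apply: sub; exists b.
Qed.

End PAminusOrder.

(** * Criteria for elementarity *)

Lemma tarski_vaught (K N : structure) (i : K -> N) : embedding i ->
  (forall phi (rho : nat -> K), (exists a : N, sat (scons a (i \o rho)) phi) ->
     exists a : K, sat (scons (i a) (i \o rho)) phi) ->
  elementary i.
Proof.
move=> hi tv; split=> // phi rho.
have evalE r s : i (eval r s) = eval (i \o r) s.
  by elim: s => //= [||s <- t <-|s <- t <-]; case: hi.
elim: phi rho => [s t|s t||p IHp|p IHp q IHq|p IHp q IHq|p IHp q IHq
  |p IHp|p IHp] rho //=; rewrite ?IHp ?IHq //.
- rewrite -!evalE; split=> [->//|]; exact: emb_inj.
- by rewrite -!evalE; exact: emb_lt.
- split=> h a; last first.
    by rewrite IHp (scons_comp i); exact: h.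
  (* A counterexample in [N] yields one in [K], by the test for [Not p]. *)
  apply: contrapT => na; have [b] := tv (Not p) rho (ex_intro _ a na).
  by rewrite /= -(scons_comp i) -IHp; apply; exact: h.
- split=> [[a]|h].
    by rewrite IHp (scons_comp i); exists (i a).
  by have [a] := tv _ _ h; exists a; rewrite IHp (scons_comp i).
Qed.

(** Truth in [M] and in [K] is compared through [N]. This makes the supremum an elementary extension
    of [M] as soon as it is elementary in [N]. *)
Lemma elementary_cancel (M K N : structure) (f : M -> K) (g : K -> N) :
  elementary (g \o f) -> elementary g -> elementary f.
Proof.
move=> hgf hg; split=> [|phi rho]; last first.
  by rewrite (elem_sat hgf) (elem_sat hg).
split.
- by move=> a b e; apply: (emb_inj hgf); rewrite /= e.
- by apply: (emb_inj hg); rewrite (emb_zero hg) -(emb_zero hgf).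
- by apply: (emb_inj hg); rewrite (emb_one hg) -(emb_one hgf).
- by move=> a b; apply: (emb_inj hg); rewrite (emb_add hg) -(emb_add hgf).
- by move=> a b; apply: (emb_inj hg); rewrite (emb_mul hg) -(emb_mul hgf).
- by move=> a b; rewrite (emb_lt hgf) (emb_lt hg).
Qed.

(** * Collection and elementarity of the supremum *)

Section Collection.
Variable M : structure.

Lemma of_sup_embedding (N : structure) (hN : models N PAminus) (j : M -> N)
  (hj : embedding j) : embedding (of_sup hN hj).
Proof. by split=> // -[a ha] [b hb] /= ab; exact: eq_exist. Qed.

Lemma Coll_all_formulas :
  models M (fun psi => exists n, Coll (Sigma n) psi) ->
  forall k l phi (rho : nat -> M), sat rho (coll k l phi).
Proof.
move=> hC k l phi rho; have [psi /prenex_Sigma[n hn] e] := prenex_form phi.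
have : sat rho (coll k l psi) by apply: hC; exists n, k, l, psi.
rewrite !sat_coll => h u hu; have [x /hu [y]|v hv] := h u.
  by rewrite -e; exists y.
exists v; move: hv; rewrite !sat_coll_bounded => hv x /hv[y [yv]].
by rewrite e; exists y.
Qed.

(* Collection for [exists w, phi w x -> phi y x], whose hypothesis holds
   trivially, bounds the witnesses of all satisfiable instances of [phi]. *)
Lemma elementary_of_sup :
  (forall k l phi (rho : nat -> M), sat rho (coll k l phi)) ->
  forall (N : structure) (hN : models N PAminus) (j : M -> N)
    (hj : elementary j), elementary (of_sup hN hj).
Proof.
move=> hC N hN j hj; apply: tarski_vaught; first exact: of_sup_embedding.
move=> phi rho [a0 ha0].
have [n hn] := sat_finite_support N phi.
(* Index 0 of [psi] is y; [up succn] keeps the bound w at 0 and skips y. *)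
pose psi := Imp (Ex (ren (up succn) phi)) phi.
(* Membership in the supremum gives a weak inequality, and collection needs a strict one, hence the
   added [one]. *)
have /choice[b hb] i : exists b : M, lt (sval (rho i)) (j b).
  have [b hb] := svalP (rho i); exists (add b one).
  rewrite (emb_add hj) (emb_one hj); apply: (PAminus_le_lt_trans hN hb).
  exact: PAminus_lt_succ.
have sat_psi (K : structure) (d y : nat -> K) : sat (vcat 1 y d) psi <->
    ((exists a, sat (scons a d) phi) -> sat (scons (y 0) d) phi).
  rewrite vcat1 /psi /=.
  suff -> : (exists a, sat (scons a (scons (y 0) d)) (ren (up succn) phi)) =
      (exists a, sat (scons a d) phi) by [].
  by apply: eq_exists => a; apply/propext; rewrite sat_ren scons_up.
(* [b] is both the bound u and the assignment of the parameters, whose values do not affect [phi] by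
   the choice of [n]. *)
have := hC n 1 psi b; rewrite sat_coll => /(_ b)[x _|v].
  have [[a ha]|hx] := pselect (exists a, sat (scons a (vcat n x b)) phi).
    by exists (fun=> a); rewrite sat_psi.
  by exists b; rewrite sat_psi.
move=> /(elem_sat hj); rewrite [X in sat X](_ : _ =
    vcat 1 (j \o v) (vcat n (j \o b) (j \o b))); last first.
  by rewrite vcat_comp; congr vcat; exact: vcat_comp.
(* In [N] the tuple x need not come from [M], so it may be taken to be [rho]. *)
rewrite sat_coll_bounded => /(_ (fun i => sval (rho i)))[i _|y [yv]].
  exact: hb.
have phi_local a :
    sat (scons a (vcat n (fun i => sval (rho i)) (j \o b))) phi <->
    sat (scons a (of_sup hN hj \o rho)) phi.
  by apply: hn => -[|i] //= /ltnW ni; rewrite vcat_ltE.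
rewrite sat_psi phi_local => hy.
have y0 : in_sup j (y 0) by exists (v 0); left; exact: yv.
exists (exist _ (y 0) y0 : sup hN hj); apply: hy; exists a0.
by rewrite phi_local.
Qed.

(* Otherwise, taking in an ultrapower over a cofinal ultrafilter the class of
   the tuples [x w] whose witnesses are not all below [w] gives an element of
   the supremum of [M] whose witnesses cannot all lie in that supremum. *)
Lemma elementary_of_sup_coll : models M PAminus ->
  (forall (N : structure) (hN : models N PAminus) (j : M -> N)
    (hj : elementary j), elementary (of_sup hN hj)) ->
  forall k l phi (rho : nat -> M), sat rho (coll k l phi).
Proof.
move=> hM hsup k l phi rho; rewrite sat_coll => u hu; apply: contrapT => hv.
have [U hU cofinal] := cofinal_ultrafilter hM.
(* Failure for the constant bounds (w, ..., w) suffices, so [M] itself can index the ultrapower. *)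
have /choice[x hx] w : exists x, (forall i, i < k -> lt (x i) (u i)) /\
    ~ exists y, (forall i, i < l -> lt (y i) w) /\
      sat (vcat l y (vcat k x rho)) phi.
  apply: contrapT => hw; apply: hv; exists (fun=> w).
  rewrite sat_coll_bounded => x hxu; apply: contrapT => hy.
  by apply: hw; exists x.
pose N := ultrapower U M; pose j : M -> N := @diagonal _ U M.
have hN : models N PAminus by exact: ultrapower_models.
have hj : elementary j by exact: diagonal_elementary.
have hK := hsup N hN j hj.
pose X i : N := uclass U (x^~ i).
(* Below [k] the bound [u i] puts [X i] in the supremum; the other entries default to [zero]. *)
have /choice[c hc] i : exists c : sup hN hj, i < k -> sval c = X i.
  have [ik|] := boolP (i < k); last by exists zero.
  suff Xi : in_sup j (X i) by exists (exist _ (X i) Xi).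
  exists (u i); left; rewrite uclass_lt; apply: filterE => w.
  by have [h _] := hx w; exact: h.
pose tau := vcat k c (to_sup hN hj \o rho).
have tauE : of_sup hN hj \o tau =
    (fun i => uclass U (fun w => vcat k (x w) rho i)).
  apply/funext => i; rewrite /tau /= /vcat.
  by case: ifP => // ik; rewrite -[RHS]/(X i) -hc.
(* The tuple [x w] has a witness in [M] at every index w, so its class has one in [N], hence in the
   supremum by the assumed elementarity. *)
have : sat tau (exs l phi).
  rewrite (elem_sat hK) [X in sat X]tauE Los; apply: filterE => w.
  by rewrite sat_exs; have [/hu] := hx w.
rewrite sat_exs => -[y]; rewrite (elem_sat hK).
have /choice[g hg] i : exists g : M -> M, sval (y i) = uclass U g.
  exact: uclass_surj.
have /choice[b hb] i : exists b, le (sval (y i)) (j b) by exact: svalP (y i).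
rewrite [X in sat X](_ : _ = (fun i => uclass U (fun w =>
    vcat l (g^~ w) (vcat k (x w) rho) i))); last first.
  apply/funext => i; rewrite /= /vcat; case: ifP => il; first exact: hg.
  by have := congr1 (@^~ (i - l)) tauE.
rewrite Los => hphi.
(* The witness lies below some [j (b i)], and almost every w exceeds [b i]. *)
have gU i : U (fun w => lt (g i w) w).
  have : U (fun w => le (g i w) (b i)).
    move: (hb i); rewrite hg => hgb.
    by apply/(Los hU (Le (Var 0) (Var 1)) (scons (g i) (fun _ _ => b i))).
  apply: filterS2 (cofinal (b i)) => w bw gb.
  exact: (PAminus_le_lt_trans hM gb bw).
(* Finitely many sets of the ultrafilter are intersected; any index w at which [phi] also holds then
   contradicts the choice of [x w]. *)
have gallU : U (fun w => forall i : 'I_l, lt (g i w) w).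
  by apply: filter_forall => i; exact: gU.
have [w [hphiw hgw]] := filter_ex (filterI hphi gallU).
have [_] := hx w; apply; exists (g^~ w); split=> // i il.
exact: (hgw (Ordinal il)).
Qed.

End Collection.

Theorem corollary4p7 (M : structure) (hM : models M PAminus) :
  let P1 := models M (fun psi => exists n : nat, Coll (Sigma n) psi) in
  let P2 := forall (N : structure) (hN : models N PAminus)
                   (j : M -> N) (hj : elementary j),
      elementary (to_sup hN hj) /\ elementary (of_sup hN hj) in
  let P3 := forall (N : structure) (hN : models N PAminus)
                   (j : M -> N) (hj : elementary j),
      elementary (of_sup hN hj) in
  (P1 <-> P2) /\ (P2 <-> P3).
Proof.
move=> P1 P2 P3.
have P13 : P1 -> P3 by move=> /Coll_all_formulas/elementary_of_sup.
have P31 : P3 -> P1.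
  by move=> h psi [n [k [l [phi [_ ->]]]]] rho; exact: elementary_of_sup_coll.
have P23 : P2 -> P3 by move=> h N hN j hj; case: (h N hN j hj).
have P32 : P3 -> P2.
  move=> h N hN j hj; split; last exact: h.
  (* The composite of [to_sup] and [of_sup] is convertible to [j]. *)
  exact: (@elementary_cancel _ _ _ _ (of_sup hN hj)).
by split; split; auto.
Qed.
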